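(* Let $X$ be a finite-dimensional real or complex inner product space (Hermitian in the complex case), let $A\in\bigwedge^pX$ and $B\in\bigwedge^qX$ be nonzero blades, and let $B=B_P\wedge B_\perp$ be a projective-orthogonal decomposition of $B$ with respect to $A$. Then $$A\lrcorner B=\|A\|\|B\|\cos\Theta_{A,B}\;B_\perp,$$ where $\Theta_{A,B}$ is the oriented asymmetric angle with respect to the same associated principal bases used in the decomposition.
   Context: $X$ is real Euclidean or complex with Hermitian product $\langle\cdot,\cdot\rangle$, conjugate-linear in the first argument. $\bigwedge X$ has the induced inner product ($\langle v_1\wedge\cdots\wedge v_p,w_1\wedge\cdots\wedge w_p\rangle=\det(\langle v_i,w_j\rangle)$, different grades being orthogonal) and norm $\|\cdot\|$. A $p$-blade ($p\ge1$) is $A=v_1\wedge\cdots\wedge v_p$; if $A\neq0$, $[A]=\mathrm{span}(v_1,\ldots,v_p)$. Scalars are $0$-blades with $[A]=\{0\}$. Contraction: the (left) contraction $A\lrcorner B$ of $A\in\bigwedge^pX$ on $B\in\bigwedge^qX$ is the unique element of $\bigwedge^{q-p}X$ such that $\langle C,A\lrcorner B\rangle=\langle A\wedge C,B\rangle$ for all $C\in\bigwedge^{q-p}X$ (so $A\lrcorner B=0$ if $p>q$). Principal bases: for subspaces $V,W$ of dimensions $p,q$, with $m=\min\{p,q\}$, the principal angles $0\le\theta_1\le\cdots\le\theta_m\le\frac\pi2$ and associated principal bases (orthonormal bases) $(e_1,\ldots,e_p)$ of $V$ and $(f_1,\ldots,f_q)$ of $W$ satisfy $\langle e_i,f_j\rangle=\delta_{ij}\cos\theta_i$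 for all $i\le p,j\le q$ (the basis of $\{0\}$ is empty). For associated principal bases $(e_i)$ of $[A]$ and $(f_j)$ of $[B]$, write $A=\epsilon_A\|A\|e_1\wedge\cdots\wedge e_p$ and $B=\epsilon_B\|B\|f_1\wedge\cdots\wedge f_q$, where $\epsilon_A,\epsilon_B$ are scalars of modulus $1$ ($\pm1$ in the real case), and $\epsilon_{A,B}=\bar\epsilon_A\epsilon_B$. A projective-orthogonal decomposition of $B$ with respect to $A$ is $B=B_P\wedge B_\perp$ with $B_P=\epsilon_B\|B\|f_1\wedge\cdots\wedge f_m$ and $B_\perp=f_{m+1}\wedge\cdots\wedge f_q$ ($B_\perp=1$ if $p\ge q$). Angles: for subspaces $V,W$, let $k$ be the real dimension of $V$ ($k=\dim V$ in the real case, $k=2\dim_{\mathbb C}V$ in the complex case), $P_W$ the orthogonal projection onto $W$, $S\subset V$ a non-degenerate $k$-dimensional parallelotope, and $\pi_{V,W}=\frac{\mathrm{vol}_k(P_W(S))}{\mathrm{vol}_k(S)}$ ($\mathrm{vol}_0$ of a point is $1$). The asymmetric angle $\Theta_{V,W}\in[0,\frac\pi2]$ is given by $\cos\Theta_{V,W}=\pi_{V,W}$ in the real case, and $\cos^2\Theta_{V,W}=\pi_{V,W}$ in the complex case. The oriented asymmetric angle $\Theta_{A,B}$ (in $[0,\pi]$ in the real case, complex-valued in the complex case) is given by $\cos\Theta_{A,B}=\epsilon_{A,B}\cos\Theta_{[A],[B]}$. *)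

(* Defs.v *)
(* The set-theoretic names below are those of finset: the analysis files come
   first. *)
From mathcomp Require Import boolp classical_sets reals sequences trigo.
From HB Require Import structures.
From mathcomp Require Import all_boot all_order all_algebra.
From mathcomp Require Import complex.
Set Implicit Arguments.
Unset Strict Implicit.
Unset Printing Implicit Defensive.
Import Order.TTheory GRing.Theory Num.Theory.
Local Open Scope ring_scope.

Section ExteriorAlgebra.
Variables (F : fieldType) (X : vectType F).
Local Notation n := (\dim {:X}).

(* [u S] is the coordinate of [u] on [b_i1 /\ ... /\ b_ir], where
   [S = {i1 < ... < ir}] and [b = vbasis {:X}]. *)
Definition ext : Type := {ffun {set 'I_n} -> F}.

HB.instance Definition _ := Vector.copy ext {ffun {set 'I_n} -> F^o}.

Definition inversions (S T : {set 'I_n}) : nat :=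
  #|[set ij : 'I_n * 'I_n | [&& ij.1 \in S, ij.2 \in T & (ij.2 < ij.1)%N]]|.

(* The sign in [b_S /\ b_T = (-1)^(inversions S T) b_(S :|: T)] for disjoint
   [S] and [T]; the product vanishes on the other pairs. *)
Definition ext_sgn (S T : {set 'I_n}) : F := (-1) ^+ inversions S T.

Definition ext_one : ext := [ffun S => (S == set0)%:R].

Definition ext_mul (u w : ext) : ext :=
  [ffun U : {set 'I_n} =>
     \sum_(S : {set 'I_n} | S \subset U)
        ext_sgn S (U :\: S) * u S * w (U :\: S)].

Lemma inversionsUl (S T U : {set 'I_n}) : [disjoint S & T] ->
  inversions (S :|: T) U = (inversions S U + inversions T U)%N.
Proof.
move=> dST; rewrite /inversions.
rewrite -cardsUI [X in (_ + X)%N](_ : _ = 0%N) ?addn0; last first.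
  apply/eqP; rewrite cards_eq0; apply/eqP/setP=> -[i j]; rewrite !inE /=.
  by apply/negP=> /andP[/and3P[iS _ _] /and3P[iT _ _]];
    rewrite (disjointFr dST iS) in iT.
by congr #|pred_of_set _|; apply/setP=> -[i j]; rewrite !inE /= andb_orl.
Qed.

Lemma inversionsUr (S T U : {set 'I_n}) : [disjoint T & U] ->
  inversions S (T :|: U) = (inversions S T + inversions S U)%N.
Proof.
move=> dTU; rewrite /inversions.
rewrite -cardsUI [X in (_ + X)%N](_ : _ = 0%N) ?addn0; last first.
  apply/eqP; rewrite cards_eq0; apply/eqP/setP=> -[i j]; rewrite !inE /=.
  by apply/negP=> /andP[/and3P[_ jT _] /and3P[_ jU _]];
    rewrite (disjointFr dTU jT) in jU.
congr #|pred_of_set _|; apply/setP=> -[i j]; rewrite !inE /=.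
by rewrite andb_orl andb_orr.
Qed.

Lemma ext_sgn0l T : ext_sgn set0 T = 1.
Proof.
rewrite /ext_sgn /inversions [X in _ ^+ X](_ : _ = 0%N) //.
by apply/eqP; rewrite cards_eq0; apply/eqP/setP=> -[i j]; rewrite !inE.
Qed.

Lemma ext_sgn0r S : ext_sgn S set0 = 1.
Proof.
rewrite /ext_sgn /inversions [X in _ ^+ X](_ : _ = 0%N) //.
by apply/eqP; rewrite cards_eq0; apply/eqP/setP=> -[i j]; rewrite !inE andbF.
Qed.

Fact ext_mulA : associative ext_mul.
Proof.
move=> u v w; apply/ffunP=> U; rewrite !ffunE.
under eq_bigr do rewrite ffunE mulr_sumr.
under [RHS]eq_bigr do rewrite ffunE mulr_sumr mulr_suml.
rewrite [RHS](exchange_big_dep (fun T : {set 'I_n} => T \subset U)) /=; last first.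
  by move=> S T SU TS; apply: subset_trans TS SU.
apply: eq_bigr => T TU.
rewrite [RHS](reindex_onto (fun Q => T :|: Q) (fun S => S :\: T)) /=; last first.
  move=> S /andP[_ /subsetP TS]; apply/setP=> i; rewrite !inE.
  by move/(_ i): TS; case: (i \in T) => //= ->.
rewrite [LHS](eq_bigl (fun Q : {set 'I_n} =>
   ((T :|: Q \subset U) && (T \subset T :|: Q))
     && ((T :|: Q) :\: T == Q))); last first.
  move=> Q; rewrite subsetUl andbT subUset TU /= subsetD.
  case: (Q \subset U) => //=; apply/idP/eqP => [/setDidPl|<-].
    by rewrite setDUl setDv set0U.
  rewrite disjoints_subset; apply/subsetP=> i.
  by rewrite !inE => /andP[].
apply: eq_bigr => Q /andP[/andP[TQU _] /eqP eQ].
have dTQ : [disjoint T & Q].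
  rewrite -eQ disjoint_sym disjoints_subset; apply/subsetP=> i.
  by rewrite !inE => /andP[].
have -> : U :\: T :\: Q = U :\: (T :|: Q) by rewrite setDDl.
rewrite eQ.
set V := U :\: (T :|: Q).
have dQV : [disjoint Q & V].
  rewrite disjoint_sym disjoints_subset; apply/subsetP=> i.
  by rewrite !inE negb_or => /andP[/andP[]].
have -> : U :\: T = Q :|: V.
  apply/setP=> i; move: (subsetP TQU i) (@disjointFr _ _ _ i dTQ); rewrite !inE.
  by case: (i \in T); case: (i \in Q) => //= h1 h2; [move: (h2 isT)|exact: h1].
rewrite /ext_sgn inversionsUl // inversionsUr // !exprD.
move: (_ ^+ _) (_ ^+ _) (_ ^+ _) (u T) (v Q) (w V) => a b c x y z.
rewrite !mulrA; do 2!congr (_ * _).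
by rewrite mulrAC (mulrC c) (mulrAC b).
Qed.

Fact ext_mul1l : left_id ext_one ext_mul.
Proof.
move=> u; apply/ffunP=> U; rewrite !ffunE (bigD1 set0) ?sub0set //=.
rewrite big1 ?addr0 ?ffunE ?eqxx ?setD0 ?ext_sgn0l ?mul1r //.
by move=> S /andP[_ /negPf S0]; rewrite ffunE S0 mulr0 mul0r.
Qed.

Fact ext_mul1r : right_id ext_one ext_mul.
Proof.
move=> u; apply/ffunP=> U; rewrite !ffunE (bigD1 U) //=.
rewrite big1 ?addr0 ?ffunE ?setDv ?eqxx ?ext_sgn0r ?mul1r ?mulr1 //.
move=> S /andP[SU nS]; rewrite ffunE setD_eq0.
case: (boolP (U \subset S)) => [US|_]; last by rewrite mulr0.
by rewrite eqEsubset SU US in nS.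
Qed.

Fact ext_mulDl : left_distributive ext_mul +%R.
Proof.
move=> u v w; apply/ffunP=> U; rewrite !ffunE -big_split /=.
by apply: eq_bigr => S _; rewrite ffunE mulrDr mulrDl.
Qed.

Fact ext_mulDr : right_distributive ext_mul +%R.
Proof.
move=> u v w; apply/ffunP=> U; rewrite !ffunE -big_split /=.
by apply: eq_bigr => S _; rewrite ffunE mulrDr.
Qed.

Fact ext_one_neq0 : ext_one != 0.
Proof.
by apply/eqP=> /ffunP/(_ set0)/eqP; rewrite !ffunE eqxx oner_eq0.
Qed.

HB.instance Definition _ := GRing.Zmodule_isNzRing.Build ext
  ext_mulA ext_mul1l ext_mul1r ext_mulDl ext_mulDr ext_one_neq0.

Fact ext_scaleAl (a : F) (u w : ext) : a *: (u * w) = (a *: u) * w.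
Proof.
apply/ffunP=> U; rewrite !ffunE scaler_sumr.
by apply: eq_bigr => S _; rewrite ffunE /GRing.scale /= !mulrA (mulrC a).
Qed.

Fact ext_scaleAr (a : F) (u w : ext) : a *: (u * w) = u * (a *: w).
Proof.
apply/ffunP=> U; rewrite !ffunE scaler_sumr.
apply: eq_bigr => S _; rewrite ffunE /GRing.scale /= mulrC -!mulrA.
by do 2!congr (_ * _); rewrite mulrC.
Qed.

HB.instance Definition _ := GRing.Lmodule_isLalgebra.Build F ext ext_scaleAl.
HB.instance Definition _ := GRing.Lalgebra_isAlgebra.Build F ext ext_scaleAr.

Definition vec_ext (v : X) : ext :=
  [ffun S : {set 'I_n} =>
     \sum_(i < n | S == [set i]) coord (vbasis {:X}) i v].

Definition wedge (s : seq X) : ext := \prod_(v <- s) vec_ext v.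

Definition is_grade (r : nat) (u : ext) : Prop :=
  forall S : {set 'I_n}, u S != 0 -> #|S| = r.

End ExteriorAlgebra.

Section InducedProduct.
Variables (F : fieldType) (X : vectType F) (theta : F -> F) (ip : X -> X -> F).
Local Notation n := (\dim {:X}).

Definition gram_det (s t : seq X) : F :=
  if size s == size t
  then \det (\matrix_(i < size s, j < size s) ip s`_i t`_j) else 0.

Definition basis_vectors (S : {set 'I_n}) : seq X :=
  [seq (vbasis {:X})`_i | i : 'I_n <- enum S].

(* The sesquilinear extension ([theta]-linear in the first argument) of the
   Gram determinants of the basis blades; [ext_ip_wedge] below gives its value
   on arbitrary blades. *)
Definition ext_ip (u w : ext X) : F :=
  \sum_(S : {set 'I_n}) \sum_(T : {set 'I_n})
     theta (u S) * w T * gram_det (basis_vectors S) (basis_vectors T).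

End InducedProduct.

Section InducedProductTheory.
Variables (F : fieldType) (X : vectType F) (theta : {rmorphism F -> F}).
Variable ip : X -> X -> F.
Hypothesis ip_linear : forall u a v w, ip u (a *: v + w) = a * ip u v + ip u w.
Hypothesis ip_herm : forall u v, ip u v = theta (ip v u).
Local Notation n := (\dim {:X}).
Implicit Types (s t r : seq X) (S T : {set 'I_n}).

Let gd := gram_det ip.
Let b (i : 'I_n) : X := (vbasis {:X})`_i.

Let gd_linear s r r' a x y :
  gd s (r ++ (a *: x + y) :: r') =
  a * gd s (r ++ x :: r') + gd s (r ++ y :: r').
Proof.
have sz z : size (r ++ z :: r') = (size r + size r').+1.
  by rewrite size_cat /= addnS.
rewrite /gd /gram_det !sz; case: eqP => [es|_]; last by rewrite mulr0 addr0.
have hr : (size r < size s)%N by rewrite es ltnS leq_addr.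
pose i0 := Ordinal hr.
pose M z := \matrix_(i < size s, j < size s) ip s`_i (r ++ z :: r')`_j.
suff : \det (M (a *: x + y))^T = a * \det (M x)^T + 1 * \det (M y)^T.
  by rewrite !det_tr mul1r.
have nth_r z : (r ++ z :: r')`_(size r) = z by rewrite nth_cat ltnn subnn.
have nth_nr z z' (j : 'I_(size s)) : j != i0 -> (r ++ z :: r')`_j = (r ++ z' :: r')`_j.
  move=> jr; rewrite !nth_cat; case: ltnP => // le; case: (j - size r)%N (subnK le) => //= ej.
  by case/eqP: jr; apply: val_inj; rewrite /= -ej add0n.
apply: (@determinant_multilinear _ _ _ _ _ i0).
- by apply/rowP=> j; rewrite !mxE /= !nth_r ip_linear mul1r.
- apply/matrixP=> i j; rewrite !mxE; congr (ip _ _).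
  by apply: nth_nr; rewrite eq_sym neq_lift.
- apply/matrixP=> i j; rewrite !mxE; congr (ip _ _).
  by apply: nth_nr; rewrite eq_sym neq_lift.
Qed.

Let gd_sum s r r' (I : finType) (c : I -> F) (v : I -> X) :
  gd s (r ++ (\sum_i c i *: v i) :: r') =
  \sum_i c i * gd s (r ++ v i :: r').
Proof.
apply: (big_rec2 (fun x y => gd s (r ++ x :: r') = y)) => [|i x y _ <-].
  have := gd_linear s r r' (-1) 0 0.
  by rewrite scaler0 addr0 mulN1r addNr.
by rewrite gd_linear.
Qed.

Let gd_alt s t i j : (i < j < size t)%N -> t`_i = t`_j -> gd s t = 0.
Proof.
move=> /andP[ij jt] e; rewrite /gd /gram_det; case: eqP => // es.
rewrite -es in jt; have it := ltn_trans ij jt.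
rewrite -det_tr (@determinant_alternate _ _ _ (Ordinal it) (Ordinal jt)) //.
  by rewrite -val_eqE /= neq_ltn ij.
by move=> l; rewrite !mxE /= e.
Qed.

Let gd_swap s r r' x y : gd s (r ++ x :: y :: r') = - gd s (r ++ y :: x :: r').
Proof.
have alt z : gd s (r ++ z :: z :: r') = 0.
  apply: (@gd_alt _ _ (size r) (size r).+1).
    by rewrite ltnSn size_cat /= !addnS !ltnS leq_addr.
  by rewrite !nth_cat ltnn subnn ltnNge leqnSn /= subSnn.
have lin2 z z1 z2 : gd s (r ++ z :: (z1 + z2) :: r') =
    gd s (r ++ z :: z1 :: r') + gd s (r ++ z :: z2 :: r').
  have := gd_linear s (rcons r z) r' 1 z1 z2.
  by rewrite !cat_rcons scale1r mul1r.
have := alt (x + y).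
have := gd_linear s r ((x + y) :: r') 1 x y; rewrite scale1r mul1r => ->.
rewrite !lin2 !alt add0r addr0 => /eqP; rewrite addr_eq0 => /eqP.
by [].
Qed.

Let gd_move s r l r' x :
  gd s (r ++ x :: l ++ r') = (-1) ^+ size l * gd s (r ++ l ++ x :: r').
Proof.
elim: l r => [|y l IH] r; first by rewrite mul1r.
rewrite cat_cons gd_swap -cat_rcons IH cat_rcons exprS mulN1r mulNr.
by [].
Qed.

Let ltO (i j : 'I_n) := (i < j)%N.

Let ltO_sorted T : sorted ltO (enum T).
Proof.
rewrite /enum_mem -enumT sorted_filter //; first by move=> i j l; apply: ltn_trans.
have : sorted ltn (map val (enum 'I_n)) by rewrite val_enum_ord iota_ltn_sorted.
by rewrite sorted_map.
Qed.

Let ltO_eq (s1 s2 : seq 'I_n) :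
  sorted ltO s1 -> sorted ltO s2 -> s1 =i s2 -> s1 = s2.
Proof.
apply: irr_sorted_eq => [i j l|i]; first exact: ltn_trans.
exact: ltnn.
Qed.

Let lo (k : 'I_n) T := [seq j : 'I_n <- enum T | (j < k)%N].
Let hi (k : 'I_n) T := [seq j : 'I_n <- enum T | (k < j)%N].

Let ltO_tr : transitive ltO.
Proof. by move=> i j l; apply: ltn_trans. Qed.

Let mem_lo k T i : (i \in lo k T) = (i < k)%N && (i \in T).
Proof. by rewrite mem_filter mem_enum. Qed.

Let mem_hi k T i : (i \in hi k T) = (k < i)%N && (i \in T).
Proof. by rewrite mem_filter mem_enum. Qed.

Let lo_sorted k T : pairwise ltO (lo k T).
Proof. by rewrite -sorted_pairwise // sorted_filter. Qed.

Let hi_sorted k T : pairwise ltO (hi k T).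
Proof. by rewrite -sorted_pairwise // sorted_filter. Qed.

Let enum_setU1 k T : k \notin T -> enum (k |: T) = lo k T ++ k :: hi k T.
Proof.
move=> kT; apply: ltO_eq => //.
  rewrite (sorted_pairwise ltO_tr) pairwise_cat /= lo_sorted hi_sorted !andbT.
  apply/andP; split; last by apply/allP=> j; rewrite mem_hi => /andP[].
  apply/allrelP=> i j; rewrite mem_lo in_cons mem_hi => /andP[ik _].
  by case/orP=> [/eqP->//|/andP[kj _]]; apply: ltn_trans ik kj.
move=> i; rewrite mem_enum mem_cat in_cons mem_lo mem_hi in_setU1.
case: (ltngtP i k) => [lt|lt|/val_inj->]; rewrite ?eqxx ?orbT //= ?orbF.
by rewrite -val_eqE /= ltn_eqF ?orbF.
Qed.

Let enum_split k T : k \notin T -> enum T = lo k T ++ hi k T.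
Proof.
move=> kT; apply: ltO_eq => //.
  rewrite (sorted_pairwise ltO_tr) pairwise_cat lo_sorted hi_sorted !andbT.
  apply/allrelP=> i j; rewrite mem_lo mem_hi => /andP[ik _] /andP[kj _].
  exact: ltn_trans ik kj.
move=> i; rewrite mem_enum mem_cat mem_lo mem_hi.
case: (ltngtP i k) => [lt|lt|/val_inj->] //=; first by rewrite orbF.
exact: negPf.
Qed.

Let size_lo k T : size (lo k T) = inversions [set k] T.
Proof.
have -> : inversions [set k] T = #|[set j in T | (j < k)%N]|.
  rewrite -(card_imset _ (fun i j => @congr1 _ _ snd (k, i) (k, j))).
  apply: eq_card => -[i j]; rewrite !inE /=; apply/and3P/imsetP.
    by case=> /eqP-> jT jk; exists j => //; rewrite inE jT.
  by case=> l; rewrite inE => /andP[lT lk] [-> ->].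
have /card_uniqP <- : uniq (lo k T) by rewrite filter_uniq ?enum_uniq.
by apply: eq_card => j; rewrite mem_lo inE andbC.
Qed.

Let gd_basis s r k T : gd s (r ++ b k :: basis_vectors T) =
  if k \in T then 0
  else ext_sgn [set k] T * gd s (r ++ basis_vectors (k |: T)).
Proof.
case: ifPn => [kT|kT].
  have kTe : k \in enum T by rewrite mem_enum.
  have ki : (index k (enum T) < size (enum T))%N by rewrite index_mem.
  apply: (@gd_alt _ _ (size r) (size r + (index k (enum T)).+1)%N).
    rewrite size_cat /= ltn_add2l ltnS size_map ki andbT.
    by rewrite -addSnnS leq_addr.
  rewrite !nth_cat ltnn subnn ltnNge leq_addr /= addKn.
  by rewrite /= /basis_vectors (nth_map k) // nth_index.
rewrite /basis_vectors enum_setU1 // {1}(enum_split kT) !map_cat /= gd_move.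
by rewrite size_map size_lo.
Qed.

Let gd_vec_mul s r x (u : ext X) :
  \sum_T (vec_ext x * u : ext X) T * gd s (r ++ basis_vectors T) =
  \sum_T u T * gd s (r ++ x :: basis_vectors T).
Proof.
pose c i := coord (vbasis {:X}) i x.
have ex : x = \sum_i c i *: b i by rewrite {1}(coord_vbasis (memvf x)).
under [RHS]eq_bigr => T _ do rewrite {1}ex gd_sum mulr_sumr.
have mulE T : (vec_ext x * u : ext X) T =
    \sum_(i | i \in T) ext_sgn [set i] (T :\ i) * c i * u (T :\ i).
  rewrite ffunE.
  under eq_bigr do rewrite ffunE mulr_sumr mulr_suml.
  rewrite (exchange_big_dep (fun i => i \in T)) /=; last first.
    by move=> S i ST /eqP eS; move: ST; rewrite eS sub1set.
  apply: eq_bigr => i iT.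
  rewrite (big_pred1 [set i]) // => S /=.
  by case: eqP => [->|_]; rewrite ?andbF // sub1set iT.
under [LHS]eq_bigr => T _ do rewrite mulE mulr_suml.
rewrite [LHS](exchange_big_dep predT) //= [RHS]exchange_big /=; apply: eq_bigr => i _.
rewrite [RHS](bigID (fun T : {set 'I_n} => i \in T)) /= [X in _ = X + _]big1 ?add0r; last first.
  by move=> T iT; rewrite gd_basis iT !mulr0.
rewrite (reindex_onto (fun T => i |: T) (fun T => T :\ i)) /=; last first.
  by move=> T iT; rewrite setD1K.
rewrite (eq_bigl (fun T : {set 'I_n} => i \notin T)); last first.
  move=> T; rewrite setU11 /=; apply/eqP/idP => [<-|iT]; last by rewrite setU1K.
  by rewrite setD11.
apply: eq_bigr => T iT; rewrite setU1K // gd_basis (negPf iT).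
rewrite [ext_sgn _ _ * c i]mulrC -!mulrA [RHS]mulrCA; congr (_ * _).
by rewrite mulrCA.
Qed.

Let wedge_one T : (1 : ext X) T = (T == set0)%:R.
Proof. by rewrite ffunE. Qed.

Let gd_wedge s r t :
  \sum_T wedge t T * gd s (r ++ basis_vectors T) = gd s (r ++ t).
Proof.
elim: t r => [|x t IH] r.
  rewrite /wedge big_nil (bigD1 set0) //= wedge_one eqxx mul1r.
  rewrite big1 ?addr0; last by move=> T /negPf T0; rewrite wedge_one T0 mul0r.
  by rewrite /basis_vectors enum_set0.
rewrite /wedge big_cons gd_vec_mul -cat_rcons -IH.
by apply: eq_bigr => T _; rewrite cat_rcons.
Qed.

Let gd_herm s t : gd s t = theta (gd t s).
Proof.
rewrite /gd /gram_det; case: eqP => [e|ne]; last first.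
  by rewrite eq_sym; case: eqP => [/ne//|]; rewrite rmorph0.
rewrite e eqxx -det_map_mx -det_tr; congr (\det _).
by apply/matrixP=> i j; rewrite !mxE ip_herm.
Qed.

Lemma ext_ip_wedge s t : ext_ip theta ip (wedge s) (wedge t) = gram_det ip s t.
Proof.
rewrite /ext_ip.
under eq_bigr => S _.
  under eq_bigr => T _ do rewrite -mulrA.
  rewrite -mulr_sumr (gd_wedge _ [::]) /= gd_herm -rmorphM; over.
by rewrite -rmorph_sum (gd_wedge _ [::]) -gd_herm.
Qed.

End InducedProductTheory.

Variant scalar_kind := RealScalars | ComplexScalars.

Definition scalar_field (R : realType) (k : scalar_kind) : numFieldType :=
  match k with RealScalars => R | ComplexScalars => R[i] end.

Definition conjK (R : realType) (k : scalar_kind) :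
    {rmorphism scalar_field R k -> scalar_field R k} :=
  match k return {rmorphism scalar_field R k -> scalar_field R k} with
  | RealScalars => idfun
  | ComplexScalars => @Num.conj R[i]
  end.

Definition ReK (R : realType) (k : scalar_kind) : scalar_field R k -> R :=
  match k return scalar_field R k -> R with
  | RealScalars => id
  | ComplexScalars => @complex.Re R
  end.

Definition ofR (R : realType) (k : scalar_kind) : R -> scalar_field R k :=
  match k return R -> scalar_field R k with
  | RealScalars => id
  | ComplexScalars => fun x => (x%:C)%C
  end.

Definition cexp (R : realType) (z : R[i]) : R[i] :=
  let: (x +i* y)%C := z in ((expR x)%:C * (cos y +i* sin y))%C.

Definition ccos (R : realType) (z : R[i]) : R[i] :=
  (cexp ('i%C * z) + cexp (- ('i%C * z))) / 2.

Definition cosK (R : realType) (k : scalar_kind) : scalar_field R k -> scalar_field R k :=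
  match k return scalar_field R k -> scalar_field R k with
  | RealScalars => @cos R
  | ComplexScalars => @ccos R
  end.

Section Grassmann.
Variables (R : realType) (k : scalar_kind) (X : vectType (scalar_field R k)).
Variable dotp : {dot X for conjK R k}.
Implicit Types (V W : {vspace X}) (A B C D : ext X).

(* The forms of sesquilinear are linear in the first argument, here the
   product is conjugate-linear in it. *)
Definition ip (u v : X) : scalar_field R k := dotp v u.

Definition ext_dot (A B : ext X) : scalar_field R k := ext_ip (conjK R k) ip A B.

Local Notation "''[' u , v ]" := (ip u v) : ring_scope.
Local Notation "''[' A , B ]_ext" := (ext_dot A B)
  (format "''[' A ,  B ]_ext") : ring_scope.

Lemma ext_dot_wedge (s t : seq X) :
  '[wedge s, wedge t]_ext = gram_det ip s t.
Proof.
apply: ext_ip_wedge => [u a v w|u v]; first by rewrite /ip linearPl.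
by rewrite /ip hermC expr0 mul1r.
Qed.

Definition ext_norm A : R := Num.sqrt (ReK '[A, A]_ext).

(* [is_contraction r A B D]: [D] is the contraction of [A] on [B], where [r] is
   the grade of [B] minus that of [A]. *)
Definition is_contraction (r : nat) A B D : Prop :=
  is_grade r D /\ forall C, is_grade r C -> '[C, D]_ext = '[A * C, B]_ext.

(* For [A] of grade [p] and [B] of grade [q]. *)
Definition contraction (p q : nat) A B : ext X :=
  if (p <= q)%N then xget 0 [set D | is_contraction (q - p) A B D]%classic
  else 0.

(* [A] is a [p]-blade, and [V] is its space. *)
Definition blade_spans (p : nat) A V : Prop :=
  if p is 0 then (exists c : scalar_field R k, A = c%:A) /\ V = 0%VS
  else exists v : p.-tuple X, A = wedge v /\ V = <<v>>%VS.

Definition is_blade (p : nat) A : Prop := exists V, blade_spans p A V.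

Definition blade_space (p : nat) A : {vspace X} :=
  xget 0%VS [set V | blade_spans p A V]%classic.

Definition orthonormal_basis V (e : seq X) : Prop :=
  basis_of V e /\ orthonormal dotp e.

Definition principal_bases (p q : nat) V W
    (e : p.-tuple X) (f : q.-tuple X) : Prop :=
  [/\ orthonormal_basis V e, orthonormal_basis W f
    & exists theta : (minn p q).-tuple R,
        [/\ {in theta, forall t, 0 <= t <= trigo.pi / 2},
            sorted <=%R theta
          & forall (i : 'I_p) (j : 'I_q),
              '[tnth e i, tnth f j] =
              (if i == j :> nat then ofR k (cos theta`_i) else 0)]].

(* [A = eps ||A|| e_1 /\ ... /\ e_p] with [eps] of modulus 1. *)
Definition blade_sign (A : ext X) (e : seq X) (eps : scalar_field R k) : Prop :=
  `|eps| = 1 /\ A = (eps * ofR k (ext_norm A)) *: wedge e.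

(* The [d]-dimensional volume of the parallelotope with edges [u_i] (possibly
   degenerate), as the square root of the Gram determinant of the edges for the
   real Euclidean structure [Re <u, v>]. *)
Definition vol (d : nat) (u : 'I_d -> X) : R :=
  Num.sqrt (\det (\matrix_(i < d, j < d) ReK '[u i, u j])).

Definition real_dim V : nat :=
  match k with RealScalars => \dim V | ComplexScalars => (2 * \dim V)%N end.

Definition real_free (d : nat) (u : 'I_d -> X) : Prop :=
  forall c : 'I_d -> R, \sum_(i < d) ofR k (c i) *: u i = 0 -> forall i, c i = 0.

(* Edges of a non-degenerate parallelotope of dimension [real_dim V] in [V]. *)
Definition full_parallelotope V (u : 'I_(real_dim V) -> X) : Prop :=
  (forall i, u i \in V) /\ real_free u.

Definition orth_proj W : X -> X := daddv_pi W (orthov dotp W).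

(* The ratio does not depend on the parallelotope. *)
Definition proj_factor V W : R :=
  xget 0 [set r | exists2 u : 'I_(real_dim V) -> X, full_parallelotope u
                  & r = vol (orth_proj W \o u) / vol u]%classic.

Definition asym_angle V W : R :=
  match k with
  | RealScalars => acos (proj_factor V W)
  | ComplexScalars => acos (Num.sqrt (proj_factor V W))
  end.

Definition angle_range : scalar_field R k -> Prop :=
  match k return scalar_field R k -> Prop with
  | RealScalars => fun t => 0 <= t <= trigo.pi
  | ComplexScalars => fun=> True
  end.

(* In the complex case the cosine does not determine the angle. *)
Definition is_oriented_angle V W (epsA epsB Theta : scalar_field R k) : Prop :=
  angle_range Theta /\
  cosK Theta = conjK R k epsA * epsB * ofR k (cos (asym_angle V W)).

(* [B = BP /\ Bperp] is the decomposition of [B] with respect to [A] given by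
   the principal bases [e] and [f]. *)
Definition proj_orth_decomposition (p q : nat) A B
    (e : p.-tuple X) (f : q.-tuple X) (epsA epsB : scalar_field R k)
    (BP Bperp : ext X) : Prop :=
  [/\ principal_bases (blade_space p A) (blade_space q B) e f,
      blade_sign A e epsA, blade_sign B f epsB
    & [/\ B = BP * Bperp,
          BP = (epsB * ofR k (ext_norm B)) *: wedge (take (minn p q) f)
        & Bperp = wedge (drop (minn p q) f)]].

End Grassmann.

(* Main.v *)
(* Let c_i = cos theta_i for i < min(p, q) and c_i = 0 beyond.  For a vector
   family s of length q - p, the Gram matrix of (e_1, .., e_p, s) against
   (f_1, .., f_q) is block lower triangular with upper left block diag(c_i), so
   its determinant is c_1 ... c_p <s, f_(p+1) /\ .. /\ f_q>; as blades span their
   grade and the product is nondegenerate on it, this determines the contraction. On the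
   other hand the projection maps the edges e_i of an orthonormal parallelotope
   of [A] to c_i f_i, so that cos Theta_{[A],[B]} = c_1 ... c_p (each factor
   occurs twice in the complex volume ratio, for e_i and i e_i).  If p > q some
   c_i is zero and both sides vanish. *)
From mathcomp Require Import classical_sets reals trigo.
From HB Require Import structures.
From mathcomp Require Import all_boot all_order all_algebra.
From mathcomp Require Import complex ring.
(* Defs comes last: its cosK is not the cancellation lemma cosK of trigo. *)
Require Import Defs.
Set Implicit Arguments.
Unset Strict Implicit.
Unset Printing Implicit Defensive.
Import Order.TTheory GRing.Theory Num.Theory.
Local Open Scope ring_scope.

(** * Blades in the coordinates of the exterior algebra, and grades *)

Lemma wedge_cat (F : fieldType) (X : vectType F) (s t : seq X) :
  wedge (s ++ t) = wedge s * wedge t.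
Proof. exact: big_cat. Qed.

Lemma vec_ext_vbasis (F : fieldType) (X : vectType F) (i : 'I_(\dim {:X})) :
  vec_ext (vbasis {:X})`_i = [ffun S : {set 'I_(\dim {:X})} => (S == [set i])%:R].
Proof.
apply/ffunP=> S; rewrite !ffunE big_mkcond (bigD1 i) //= big1 ?addr0.
  by rewrite coord_free ?(basis_free (vbasisP _)) // eqxx; case: eqP.
move=> j ji; rewrite coord_free ?(basis_free (vbasisP _)) //.
by rewrite [i == j]eq_sym (negPf ji) if_same.
Qed.

(** Induction on the list: the head index is smaller than all later ones, so putting its vector in
    front creates no inversion and the sign is 1. *)
Lemma wedge_vbasis_sorted (F : fieldType) (X : vectType F) (l : seq 'I_(\dim {:X})) :
  sorted (fun i j : 'I_(\dim {:X}) => (i < j)%N) l ->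
  wedge [seq (vbasis {:X})`_(i : 'I_(\dim {:X})) | i <- l] =
  [ffun U : {set 'I_(\dim {:X})} => (U == [set x in l])%:R].
Proof.
elim: l => [|i l IH] /=.
  move=> _; rewrite /wedge big_nil; apply/ffunP=> U; rewrite !ffunE.
  by congr (_ == _)%:R; apply/setP=> x; rewrite !inE.
move=> hl; rewrite /wedge big_cons [X in _ * X]IH ?(path_sorted hl) //.
have il : {in l, forall j : 'I__, (i < j)%N}.
  apply/allP; apply: order_path_min hl => a b c; exact: ltn_trans.
have nil : i \notin l by apply/negP=> /il; rewrite ltnn.
apply/ffunP=> U; rewrite vec_ext_vbasis !ffunE.
under eq_bigr do rewrite !ffunE.
have eU : (U == [set x in i :: l]) = (i \in U) && (U :\ i == [set x in l]).
  rewrite set_cons; apply/eqP/andP => [->|[iU /eqP<-]]; last by rewrite setD1K.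
  by rewrite setU11 setU1K ?inE.
rewrite eU; have [iU|iU] /= := boolP (i \in U); last first.
  rewrite big1 // => S SU; case: eqP => [eS|]; last by rewrite mulr0 mul0r.
  by rewrite eS sub1set (negPf iU) in SU.
rewrite (bigD1 [set i]) ?sub1set //= eqxx mulr1 big1 ?addr0; last first.
  by move=> S /andP[_ /negPf->]; rewrite mulr0 mul0r.
case: eqP => [->|_]; rewrite ?mulr0 // mulr1 /ext_sgn /inversions.
rewrite (_ : [set _ | _] = set0) ?cards0 //; apply/setP=> -[a b]; rewrite !inE /=.
apply/negP=> /and3P[/eqP-> /il h1 h2].
by move: (ltn_trans h1 h2); rewrite ltnn.
Qed.

Lemma wedge_basis_vectors (F : fieldType) (X : vectType F) (S : {set 'I_(\dim {:X})}) :
  wedge (basis_vectors S) = [ffun U : {set 'I_(\dim {:X})} => (U == S)%:R] :> ext X.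
Proof.
rewrite wedge_vbasis_sorted.
  by apply/ffunP=> U; rewrite !ffunE; congr (_ == _)%:R; apply/setP=> x; rewrite inE mem_enum.
rewrite /enum_mem -enumT sorted_filter //; first by move=> i j l; apply: ltn_trans.
have : sorted ltn (map val (enum 'I_(\dim {:X}))) by rewrite val_enum_ord iota_ltn_sorted.
by rewrite sorted_map.
Qed.

Lemma ext_expand (F : fieldType) (X : vectType F) (u : ext X) :
  u = \sum_(S : {set 'I_(\dim {:X})}) u S *: wedge (basis_vectors S).
Proof.
apply/ffunP=> U; rewrite sum_ffunE (bigD1 U) //= wedge_basis_vectors !ffunE eqxx.
rewrite /GRing.scale /= mulr1 big1 ?addr0 // => S SU.
by rewrite wedge_basis_vectors !ffunE eq_sym (negPf SU) /GRing.scale /= mulr0.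
Qed.

Lemma is_gradeZ (F : fieldType) (X : vectType F) r a (u : ext X) :
  is_grade r u -> is_grade r (a *: u).
Proof. by move=> hu S; rewrite ffunE /GRing.scale /= mulf_eq0 negb_or => /andP[_ /hu]. Qed.

Lemma is_gradeB (F : fieldType) (X : vectType F) r (u v : ext X) :
  is_grade r u -> is_grade r v -> is_grade r (u - v).
Proof.
move=> hu hv S; rewrite !ffunE; have [u0|/hu//] := eqVneq (u S) 0.
by rewrite u0 sub0r oppr_eq0 => /hv.
Qed.

(** A vector has nonzero coordinates only on singletons, so each factor adds exactly one element to
    the index sets of the product. *)
Lemma is_grade_wedge (F : fieldType) (X : vectType F) (s : seq X) :
  is_grade (size s) (wedge s).
Proof.
elim: s => [|x s IH] S.
  rewrite /wedge big_nil !ffunE; case: (S =P set0) => [-> _|_]; first by rewrite cards0.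
  by rewrite eqxx.
rewrite /wedge big_cons ffunE; apply: contraNeq => hS; rewrite big1 // => T TS.
rewrite ffunE; have [i /eqP Ti|h] := pickP (fun i => T == [set i]); last first.
  by rewrite (big_pred0 _ _ _ _ h) mulr0 mul0r.
rewrite -/(wedge s); have [->|/IH h] := eqVneq (wedge s (S :\: T)) 0; first by rewrite mulr0.
by case/eqP: hS; rewrite /= -h (cardsD1 i S) -sub1set -Ti TS.
Qed.

(** * Gram determinants of block, diagonal and dual shape *)

Section Gram.
Variables (F : fieldType) (X : vectType F) (ip : X -> X -> F).
Implicit Types s t : seq X.

Lemma gram_detE n s t : size s = n -> size t = n ->
  gram_det ip s t = \det (\matrix_(i < n, j < n) ip s`_i t`_j).
Proof. by move=> <- e; rewrite /gram_det e eqxx. Qed.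

(** The orthogonality hypothesis kills the upper right block of the Gram matrix. If [s2] and [t2]
    differ in length, both sides are 0 by the convention in [gram_det]. *)
Lemma gram_det_block s1 s2 t1 t2 : size s1 = size t1 ->
  {in s1 & t2, forall x y, ip x y = 0} ->
  gram_det ip (s1 ++ s2) (t1 ++ t2) = gram_det ip s1 t1 * gram_det ip s2 t2.
Proof.
move=> e1 h; have [e2|ne2] := eqVneq (size s2) (size t2); last first.
  by rewrite [gram_det ip s2 t2]/gram_det (negPf ne2) mulr0 /gram_det !size_cat e1 eqn_add2l (negPf ne2).
rewrite (@gram_detE (size s1 + size s2)) ?size_cat // ?e1 ?e2 //.
rewrite -e1 -e2 (@gram_detE (size s1) s1 t1) // (@gram_detE (size s2) s2 t2) //.
set M := \matrix_(_, _) _; rewrite -[M]submxK.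
have -> : ursubmx M = 0.
  apply/matrixP=> i j; rewrite !mxE !nth_cat /= ltn_ord -e1 ltnNge leq_addr /= addKn.
  by apply: h; apply: mem_nth; rewrite // -e2.
rewrite det_lblock; congr (_ * _); congr (\det _); apply/matrixP=> i j; rewrite !mxE !nth_cat /=.
  by rewrite -e1 !ltn_ord.
by rewrite -e1 !ltnNge !leq_addr /= !addKn.
Qed.

Lemma gram_det_diag n s t (c : nat -> F) : size s = n -> size t = n ->
  (forall i j, (i < n)%N -> (j < n)%N -> ip s`_i t`_j = if i == j then c i else 0) ->
  gram_det ip s t = \prod_(i < n) c i.
Proof.
move=> es et h; rewrite (gram_detE es et).
rewrite (_ : \matrix_(_, _) _ = diag_mx (\row_i c i)).
  by rewrite det_diag; apply: eq_bigr => i _; rewrite mxE.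
by apply/matrixP=> i j; rewrite !mxE h //= -(inj_eq val_inj) /=; case: eqP.
Qed.

(** If [S] and [T] have equal size but differ, some [k] of [S] is outside [T], and the row of [d k]
    is zero. Such families read off the coordinates of an element of the exterior algebra. *)
Lemma gram_det_dual (d : 'I_(\dim {:X}) -> X) (S T : {set 'I_(\dim {:X})}) :
  (forall i j : 'I_(\dim {:X}), ip (d i) (vbasis {:X})`_j = (i == j)%:R) ->
  gram_det ip [seq d i | i <- enum S] (basis_vectors T) = (S == T)%:R.
Proof.
move=> hd.
have [/eqP eST|nST] := boolP (#|S| == #|T|); last first.
  rewrite /gram_det !size_map -!cardE (negPf nST).
  by case: (S =P T) nST => [->|//]; rewrite eqxx.
have [|/eqP nST'] := eqVneq S T.
  move=> <-; rewrite (@gram_det_diag #|S| _ _ (fun=> 1)) ?size_map -?cardE ?big1 //.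
  (* [nth_map] asks for a default index; an element of [S] provides one. *)
  move=> i j iS jS; have [k0 _] : exists k0, k0 \in S.
    by apply/card_gt0P; apply: leq_ltn_trans iS.
  rewrite cardE in iS jS.
  by rewrite /basis_vectors !(nth_map k0) // hd nth_uniq ?enum_uniq //; case: eqP.
have /subsetPn[k kS kT] : ~~ (S \subset T).
  by apply/negP=> ST; apply: nST'; apply/eqP; rewrite eqEcard ST eST leqnn.
rewrite (gram_detE (n := #|S|)) ?size_map -?cardE //.
have ki : (index k (enum S) < #|S|)%N by rewrite cardE index_mem mem_enum.
rewrite (expand_det_row _ (Ordinal ki)) big1 // => j _.
rewrite mxE /= (nth_map k) -?cardE // nth_index ?mem_enum //.
rewrite (nth_map k) -?cardE -?eST // hd.
case: eqP => [e|]; last by rewrite mul0r.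
by case/negP: kT; rewrite e -mem_enum mem_nth // -cardE -eST.
Qed.

End Gram.

(** * Sesquilinearity of the induced product *)

Section ExtIp.
Variables (F : fieldType) (X : vectType F) (theta : {rmorphism F -> F}).
Variable ip : X -> X -> F.

Lemma ext_ip_suml (I : finType) (c : I -> F) (u : I -> ext X) w :
  ext_ip theta ip (\sum_i c i *: u i) w = \sum_i theta (c i) * ext_ip theta ip (u i) w.
Proof.
rewrite /ext_ip; under [RHS]eq_bigr do rewrite mulr_sumr.
rewrite [RHS]exchange_big /=; apply: eq_bigr => S _.
under [RHS]eq_bigr do rewrite mulr_sumr.
rewrite [RHS]exchange_big /=; apply: eq_bigr => T _.
rewrite sum_ffunE rmorph_sum !mulr_suml; apply: eq_bigr => i _.
by rewrite ffunE rmorphM !mulrA.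
Qed.

Lemma ext_ip_sumr (I : finType) (c : I -> F) (u : I -> ext X) w :
  ext_ip theta ip w (\sum_i c i *: u i) = \sum_i c i * ext_ip theta ip w (u i).
Proof.
rewrite /ext_ip; under [RHS]eq_bigr do rewrite mulr_sumr.
rewrite [RHS]exchange_big /=; apply: eq_bigr => S _.
under [RHS]eq_bigr do rewrite mulr_sumr.
rewrite [RHS]exchange_big /=; apply: eq_bigr => T _.
rewrite sum_ffunE mulr_sumr !mulr_suml; apply: eq_bigr => i _.
by rewrite ffunE mulrCA !mulrA.
Qed.

Lemma ext_ipZl c u w : ext_ip theta ip (c *: u) w = theta c * ext_ip theta ip u w.
Proof.
have := ext_ip_suml (fun i : 'I_1 => c) (fun=> u) w.
by rewrite !big_ord1.
Qed.

Lemma ext_ipZr c u w : ext_ip theta ip w (c *: u) = c * ext_ip theta ip w u.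
Proof.
have := ext_ip_sumr (fun i : 'I_1 => c) (fun=> u) w.
by rewrite !big_ord1.
Qed.

Lemma ext_ipBr u v w : ext_ip theta ip w (u - v) = ext_ip theta ip w u - ext_ip theta ip w v.
Proof.
(* The difference is a combination indexed by [bool]: [false] carries [u] with coefficient 1, [true]
   carries [v] with coefficient -1. *)
have := ext_ip_sumr (fun i : bool => (-1) ^+ i) (fun b => if b then v else u) w.
by rewrite !big_bool /= !scaleN1r !scale1r !mulN1r !mul1r addrC [RHS]addrC.
Qed.

End ExtIp.

(** * Real and complex scalars treated together, as a real Euclidean space *)

Section Scalars.
Variables (R : realType) (k : scalar_kind).
Implicit Types (x y : R) (z : scalar_field R k).

Fact ofR_zmod_morphism : zmod_morphism (@ofR R k).
Proof. by case: k => x y //=; rewrite rmorphB. Qed.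

Fact ofR_monoid_morphism : monoid_morphism (@ofR R k).
Proof. by case: k; split=> // x y /=; rewrite rmorphM. Qed.

HB.instance Definition _ :=
  GRing.isZmodMorphism.Build R (scalar_field R k) (@ofR R k) ofR_zmod_morphism.
HB.instance Definition _ :=
  GRing.isMonoidMorphism.Build R (scalar_field R k) (@ofR R k) ofR_monoid_morphism.

Fact ReK_zmod_morphism : zmod_morphism (@ReK R k).
Proof. by case: k => // -[? ?] [? ?]. Qed.

HB.instance Definition _ :=
  GRing.isZmodMorphism.Build (scalar_field R k) R (@ReK R k) ReK_zmod_morphism.

Lemma ReK_ofRM x z : ReK (ofR k x * z) = x * ReK z.
Proof. by case: k z => //= -[a b] /=; rewrite mul0r subr0. Qed.

Lemma conjK_ofR x : conjK R k (ofR k x) = ofR k x.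
Proof. by case: k => //=; rewrite /Num.conj /= oppr0. Qed.

Lemma conjKK z : conjK R k (conjK R k z) = z.
Proof. by case: k z => //= z; rewrite conjCK. Qed.

(** The dimension of the scalars over the reals, so that [real_dim V] is [scalar_dim k] times
    [\dim V]. *)
Definition scalar_dim : nat := if k is RealScalars then 1 else 2.

(** The real basis 1, or 1 and i, of the scalars; it is orthonormal for the product Re (conj z *
    w). *)
Definition scalar_unit (a : nat) : scalar_field R k :=
  match k return scalar_field R k with
  | RealScalars => 1
  | ComplexScalars => if a is 0 then 1 else 'i%C
  end.

Lemma scalar_unit_expand z :
  z = \sum_(a < scalar_dim) ofR k (ReK (conjK R k (scalar_unit a) * z)) * scalar_unit a.
Proof.
rewrite /scalar_dim /scalar_unit; case: k z => [z|[a b]].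
  by rewrite big_ord1 /= mul1r mulr1.
rewrite !big_ord_recl big_ord0 /=.
by apply/eqP; rewrite eq_complex /=; apply/andP; split; apply/eqP; ring.
Qed.

Lemma scalar_unit_orthonormal (a b : 'I_scalar_dim) :
  ReK (conjK R k (scalar_unit a) * scalar_unit b) = (a == b)%:R.
Proof.
rewrite /scalar_dim /scalar_unit; move: a b; rewrite /scalar_dim; case: k.
  by move=> a b; rewrite !ord1 /= mulr1.
move=> [[|[|//]] ?] [[|[|//]] ?] /=; rewrite -?(inj_eq val_inj) /=; ring.
Qed.

End Scalars.

(** * Dual bases, orthogonal projections and volume ratios *)

Section InnerProduct.
Variables (R : realType) (k : scalar_kind) (X : vectType (scalar_field R k)).
Variable dotp : {dot X for conjK R k}.
Implicit Types (u v w : X) (V W : {vspace X}).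

Lemma ip_conj u v : conjK R k (ip dotp u v) = ip dotp v u.
Proof. by rewrite /ip [RHS]hermC expr0 mul1r. Qed.

Lemma ip_gt0 u : u != 0 -> 0 < ip dotp u u.
Proof. exact: neq0_dnorm_gt0. Qed.

Lemma ip_eq0 u : ip dotp u u = 0 -> u = 0.
Proof.
by move=> u0; apply/eqP/negP=> /negP/ip_gt0; rewrite u0 ltxx.
Qed.

Lemma ip_sumr (I : finType) (c : I -> scalar_field R k) (v : I -> X) u :
  ip dotp u (\sum_i c i *: v i) = \sum_i c i * ip dotp u (v i).
Proof.
rewrite /ip linear_sumlz; apply: eq_bigr => i _; exact: linearZl_LR.
Qed.

Lemma ip_suml (I : finType) (c : I -> scalar_field R k) (v : I -> X) u :
  ip dotp (\sum_i c i *: v i) u = \sum_i conjK R k (c i) * ip dotp (v i) u.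
Proof.
rewrite -ip_conj ip_sumr rmorph_sum; apply: eq_bigr => i _.
by rewrite rmorphM ip_conj.
Qed.

Lemma ipZr a u v : ip dotp u (a *: v) = a * ip dotp u v.
Proof. exact: linearZl_LR. Qed.

Lemma ipZl a u v : ip dotp (a *: u) v = conjK R k a * ip dotp u v.
Proof. by rewrite -ip_conj ipZr rmorphM ip_conj. Qed.

Lemma ipBr u v w : ip dotp u (v - w) = ip dotp u v - ip dotp u w.
Proof. exact: linearBl. Qed.

(** Row [i] of the inverse Gram matrix gives the coefficients of [d i], conjugated because [ip] is
    conjugate-linear on the left. *)
Lemma dual_basis :
  exists d : 'I_(\dim {:X}) -> X,
    forall i j : 'I_(\dim {:X}), ip dotp (d i) (vbasis {:X})`_j = (i == j)%:R.
Proof.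
pose b (i : 'I_(\dim {:X})) : X := (vbasis {:X})`_i.
pose G := \matrix_(i, j) ip dotp (b i) (b j).
have Gu : G \in unitmx.
  (* A row in the left kernel of [G] yields, after conjugation, a vector [w] orthogonal to the whole
     basis, hence to itself. *)
  rewrite unitmxE unitfE; apply/det0P => -[v v0 vG]; case/eqP: v0.
  pose w := \sum_i conjK R k (v 0 i) *: b i.
  have wb j : ip dotp w (b j) = 0.
    have /matrixP/(_ 0 j) := vG; rewrite !mxE => <-; rewrite ip_suml.
    by apply: eq_bigr => i _; rewrite conjKK mxE.
  have w0 : w = 0 by apply: ip_eq0; rewrite {2}/w ip_sumr big1 // => i _; rewrite wb mulr0.
  apply/rowP=> i; rewrite mxE -[LHS]conjKK.
  have /freeP/(_ _ w0 i) -> := basis_free (vbasisP {:X}).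
  by rewrite rmorph0.
exists (fun i => \sum_l conjK R k (invmx G i l) *: b l) => i j.
rewrite ip_suml; have /matrixP/(_ i j) := mulVmx Gu; rewrite !mxE => <-.
by apply: eq_bigr => l _; rewrite conjKK mxE.
Qed.

Lemma orthonormal_ip (s : seq X) i j : orthonormal dotp s ->
  (i < size s)%N -> (j < size s)%N -> ip dotp s`_i s`_j = (i == j)%:R.
Proof.
elim: s i j => // x s IH i j /andP[/=/andP[/eqP xx h1] /andP[/andP[/allP/= h2 _] h3]].
have {}IH := IH _ _ (introT andP (conj h1 h3)).
case: i j => [|i] [|j] //= hi hj.
- by rewrite -ip_conj /ip (eqP (h2 _ (mem_nth _ _))) // rmorph0.
- by rewrite /ip (eqP (h2 _ (mem_nth _ _))).
- exact: IH.
Qed.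

Lemma orthonormal_expand p (e : p.-tuple X) v : orthonormal dotp e ->
  v \in <<e>>%VS -> v = \sum_(i < p) ip dotp e`_i v *: e`_i.
Proof.
move=> oe /coord_span ev; rewrite {1}ev; apply: eq_bigr => i _; congr (_ *: _).
rewrite {2}ev ip_sumr (bigD1 i) //= big1 ?addr0.
  by rewrite orthonormal_ip ?size_tuple // eqxx mulr1.
move=> j ji; rewrite orthonormal_ip ?size_tuple // eq_sym.
by rewrite -[_ == _]/(j == i) (negPf ji) mulr0.
Qed.

Lemma capv_orthov W : (W :&: orthov dotp W = 0)%VS.
Proof.
apply/eqP; rewrite -subv0; apply/subvP=> v; rewrite memv_cap memv0.
by move=> /andP[vW /mem_orthovP/(_ v vW) v0]; apply/eqP/ip_eq0.
Qed.

Lemma orth_projE W u w : w \in W -> {in W, forall v, ip dotp v (u - w) = 0} ->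
  orth_proj dotp W u = w.
Proof.
move=> wW hw; rewrite /orth_proj -[u](subrK w) linearD /= (daddv_pi_id (capv_orthov W) wW).
have uw : u - w \in orthov dotp W by apply/mem_orthovP.
(* On [u - w] the projections onto [W] and onto its complement add up to the identity; the second
   already is the identity there, so the first vanishes. *)
have := daddv_pi_add (capv_orthov W) (subvP (addvSr W _) _ uw).
by rewrite (daddv_pi_id _ uw) 1?capvC ?capv_orthov // => /(canRL (addrK _)); rewrite subrr => ->; rewrite add0r.
Qed.

(** The matrix under the square root in [vol]. *)
Definition real_gram d (u : 'I_d -> X) : 'M[R]_d :=
  \matrix_(i, j) ReK (ip dotp (u i) (u j)).

Lemma real_gram_comb d (M : 'M[R]_d) (b : 'I_d -> X) :
  real_gram (fun i => \sum_j ofR k (M i j) *: b j) = M *m real_gram b *m M^T.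
Proof.
apply/matrixP=> i j; rewrite !mxE ip_sumr raddf_sum; apply: eq_bigr => l _ /=.
rewrite ReK_ofRM ip_suml raddf_sum !mxE mulrC /=; congr (_ * _).
by apply: eq_bigr => l' _; rewrite conjK_ofR ReK_ofRM !mxE.
Qed.

(** A row killed by [M] would be a real linear relation between the combinations. *)
Lemma real_free_unit d (M : 'M[R]_d) (b : 'I_d -> X) :
  real_free (fun i => \sum_j ofR k (M i j) *: b j) -> M \in unitmx.
Proof.
move=> fr; rewrite unitmxE unitfE; apply/det0P => -[c c0 cM]; case/eqP: c0.
apply/rowP=> i; rewrite mxE; apply: (fr (fun i => c 0 i)).
under eq_bigr do rewrite scaler_sumr.
rewrite exchange_big big1 //= => j _.
under eq_bigr do rewrite scalerA -rmorphM.
rewrite -scaler_suml -rmorph_sum; have /matrixP/(_ 0 j) := cM.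
by rewrite !mxE => ->; rewrite rmorph0 scale0r.
Qed.

(* Every full parallelotope of [V] is the image under some invertible real
   matrix of the orthonormal one with edges [b], so its volume and that of its
   projection are both scaled by the modulus of the determinant. *)
Lemma proj_factor_orthonormal V W (b : 'I_(real_dim V) -> X) (c : 'I_(real_dim V) -> R) :
  (forall i, b i \in V) ->
  (forall v, v \in V -> v = \sum_i ofR k (ReK (ip dotp (b i) v)) *: b i) ->
  (forall i j, ReK (ip dotp (b i) (b j)) = (i == j)%:R) ->
  (forall i j, ReK (ip dotp (orth_proj dotp W (b i)) (orth_proj dotp W (b j))) =
     if i == j then c i ^+ 2 else 0) ->
  (forall i, 0 <= c i) ->
  proj_factor dotp V W = \prod_i c i.
Proof.
move=> bV bE bb bc c0.
have Gb : real_gram b = 1%:M by apply/matrixP=> i j; rewrite !mxE bb.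
have GPb : real_gram (orth_proj dotp W \o b) = diag_mx (\row_i c i ^+ 2).
  by apply/matrixP=> i j; rewrite !mxE /= bc; case: eqP.
(* Two obligations: the value is attained, by the edges [b] themselves, and every other full
   parallelotope gives the same ratio. *)
rewrite /proj_factor; apply: xget_unique => [|_ [u [uV fu] ->]].
  exists b.
    split=> // a a0 i.
    have := congr1 (fun v => ReK (ip dotp (b i) v)) a0.
    rewrite /= ip_sumr raddf_sum (bigD1 i) //= big1 ?addr0; last first.
      by move=> j ji; rewrite ReK_ofRM bb eq_sym (negPf ji) mulr0.
    by rewrite ReK_ofRM bb eqxx mulr1 /ip linear0l raddf0.
  rewrite /vol -/(real_gram (orth_proj dotp W \o b)) -/(real_gram b) Gb GPb.
  rewrite det1 sqrtr1 divr1 det_diag; under [in RHS]eq_bigr do rewrite mxE.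
  by rewrite prodrXl sqrtr_sqr ger0_norm ?prodr_ge0.
pose M := \matrix_(i, j) ReK (ip dotp (b j) (u i)).
have uE i : u i = \sum_j ofR k (M i j) *: b j.
  by rewrite {1}(bE _ (uV i)); apply: eq_bigr => j _; rewrite mxE.
have PuE i : orth_proj dotp W (u i) = \sum_j ofR k (M i j) *: orth_proj dotp W (b j).
  by rewrite uE /orth_proj linear_sum; apply: eq_bigr => j _; rewrite linearZ.
have Mu : M \in unitmx.
  by apply: (@real_free_unit _ M b) => a a0; apply: fu; rewrite -[RHS]a0;
    apply: eq_bigr => i _; rewrite -uE.
have gramE (x y : 'I_(real_dim V) -> X) : x =1 y -> real_gram x = real_gram y.
  by move=> xy; apply/matrixP=> i j; rewrite !mxE !xy.
rewrite /vol -/(real_gram (orth_proj dotp W \o u)) -/(real_gram u).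
rewrite (gramE _ _ uE) (gramE _ _ PuE) !real_gram_comb Gb.
rewrite (gramE _ (orth_proj dotp W \o b)) // GPb mulmx1 !det_mulmx det_tr det_diag.
under eq_bigr do rewrite mxE.
rewrite mulrAC -expr2 prodrXl sqrtrM ?sqr_ge0 // !sqrtr_sqr.
have pc0 : 0 <= \prod_i c i by apply: prodr_ge0 => i _.
rewrite (ger0_norm pc0).
rewrite mulrAC divff ?mul1r // normr_eq0 -unitfE -unitmxE //.
Qed.

End InnerProduct.

(** * The contraction tested on blades, and the asymmetric angle in principal bases *)

Section Contraction.
Variables (R : realType) (k : scalar_kind) (X : vectType (scalar_field R k)).
Variable dotp : {dot X for conjK R k}.
Implicit Types (A B C D E : ext X) (V W : {vspace X}).

(** Pairing with the wedge of the dual vectors indexed by [S] extracts the coordinate [E S]; where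
    that is nonzero, this wedge has grade [r]. *)
Lemma ext_dot_nondegenerate r E : is_grade r E ->
  (forall C, is_grade r C -> ext_dot dotp C E = 0) -> E = 0.
Proof.
move=> hE E0; have [d hd] := dual_basis dotp.
apply/ffunP=> S; rewrite [RHS]ffunE; apply/eqP/negP=> /negP/[dup]/hE eS /eqP[].
pose ds := [seq d i | i <- enum S].
have gds : is_grade r (wedge ds).
  by rewrite -eS cardE -(size_map d); apply: is_grade_wedge.
rewrite -(E0 _ gds) /ext_dot [in RHS](ext_expand E) ext_ip_sumr (bigD1 S) //=.
rewrite -[ext_ip _ _ _ _]/(ext_dot _ _ _) ext_dot_wedge gram_det_dual // eqxx mulr1.
rewrite big1 ?addr0 // => T TS.
rewrite -[ext_ip _ _ _ _]/(ext_dot _ _ _) ext_dot_wedge gram_det_dual //.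
by rewrite eq_sym (negPf TS) mulr0.
Qed.

(** Both sides of the defining identity are conjugate-linear in the test element, which is a
    combination of basis blades of its own grade; nondegeneracy then gives the uniqueness that
    [xget] needs. *)
Lemma contraction_eq p q A B D : (p <= q)%N -> is_grade (q - p) D ->
  (forall s : seq X, size s = (q - p)%N ->
     ext_dot dotp (wedge s) D = ext_dot dotp (A * wedge s) B) ->
  contraction dotp p q A B = D.
Proof.
move=> pq gD hD; rewrite /contraction pq.
have cD : is_contraction dotp (q - p) A B D.
  split=> // C gC; rewrite (ext_expand C) mulr_sumr.
  under [X in _ = ext_dot _ X _]eq_bigr do rewrite -scalerAr.
  rewrite /ext_dot !ext_ip_suml; apply: eq_bigr => S _.
  have [->|/gC eS] := eqVneq (C S) 0; first by rewrite rmorph0 !mul0r.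
  congr (_ * _); apply: hD.
  by rewrite size_map -cardE.
apply: xget_unique => // D' [gD' hD']; apply/eqP; rewrite -subr_eq0; apply/eqP.
apply: (@ext_dot_nondegenerate (q - p)); first exact: is_gradeB.
move=> C gC; rewrite /ext_dot ext_ipBr -!/(ext_dot _ _ _) hD' //.
by case: cD => _ ->; rewrite ?subrr.
Qed.

(** Extending the cosines by 0 beyond [minn p q] lets the product over all [i < p] cover the case
    [q < p] as well. *)
Lemma principal_bases_cos p q V W (e : p.-tuple X) (f : q.-tuple X) :
  principal_bases dotp V W e f ->
  exists c : nat -> R,
    [/\ forall i, 0 <= c i <= 1, forall i, (q <= i)%N -> c i = 0
      & forall i j, (i < p)%N -> (j < q)%N ->
          ip dotp e`_i f`_j = if i == j then ofR k (c i) else 0].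
Proof.
move=> [_ _ [theta [th _ hef]]].
exists (fun i => if (i < minn p q)%N then cos theta`_i else 0); split.
- move=> i; case: ltnP => [im|_]; last by rewrite lexx ler01.
  have /th /andP[t0 t1] : theta`_i \in theta by rewrite mem_nth ?size_tuple.
  rewrite cos_le1 andbT cos_ge0_pihalf // t1 andbT.
  by rewrite (le_trans _ t0) // oppr_le0 divr_ge0 ?pi_ge0.
- by move=> i qi; rewrite ltnNge geq_min qi orbT.
move=> i j ip jq; have := hef (Ordinal ip) (Ordinal jq).
rewrite !(tnth_nth 0) /= => ->; case: eqP => // eij.
by rewrite leq_min ip eij jq.
Qed.

(** The multiples of the [e] vectors by the scalar units form a real orthonormal basis of [V], and
    their projections stay pairwise orthogonal, with lengths [c i]. *)
Lemma cos_asym_angle p q V W (e : p.-tuple X) (f : q.-tuple X) (c : nat -> R) :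
  orthonormal_basis dotp V e -> orthonormal_basis dotp W f ->
  (forall i, 0 <= c i <= 1) -> (forall i, (q <= i)%N -> c i = 0) ->
  (forall i j, (i < p)%N -> (j < q)%N ->
     ip dotp e`_i f`_j = if i == j then ofR k (c i) else 0) ->
  cos (asym_angle dotp V W) = \prod_(i < p) c i.
Proof.
move=> [be oe] [bf of_] c01 cq hef.
have dV : \dim V = p by rewrite -(size_basis be).
have eV : V = <<e>>%VS by rewrite (span_basis be).
have fW : W = <<f>>%VS by rewrite (span_basis bf).
have mV i : (i < p)%N -> e`_i \in V.
  by move=> ip; rewrite eV memv_span // mem_nth ?size_tuple.
(* For [i >= q] the entry of [f] is the default 0, and [c i = 0], so the formula still holds. *)
have Pe i : (i < p)%N -> orth_proj dotp W e`_i = ofR k (c i) *: f`_i.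
  move=> ip; apply: orth_projE => [|v].
    have [iq|qi] := ltnP i q; last by rewrite cq // rmorph0 scale0r mem0v.
    by rewrite memvZ // fW memv_span // mem_nth ?size_tuple.
  rewrite fW => /(orthonormal_expand of_)->; rewrite ip_suml big1 // => j _.
  rewrite ipBr ipZr -(ip_conj _ e`_i) hef //.
  have [iq|qi] := ltnP i q; last first.
    by rewrite cq // rmorph0 mul0r if_same rmorph0 subrr mulr0.
  rewrite orthonormal_ip ?size_tuple // eq_sym; case: eqP => _.
    by rewrite conjK_ofR mulr1 subrr mulr0.
  by rewrite rmorph0 mulr0 subrr mulr0.
have PePe i j : (i < p)%N -> (j < p)%N ->
    ip dotp (orth_proj dotp W e`_i) (orth_proj dotp W e`_j) =
    if i == j then ofR k (c i ^+ 2) else 0.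
  move=> ip jp; rewrite !Pe // ipZl ipZr conjK_ofR.
  have [iq|qi] := ltnP i q; last first.
    by rewrite cq // expr0n rmorph0 mul0r if_same.
  have [jq|qj] := ltnP j q; last first.
    by rewrite (cq j) // rmorph0 mul0r mulr0 ltn_eqF // (leq_trans iq).
  rewrite orthonormal_ip ?size_tuple //; case: eqP => [->|_]; last by rewrite !mulr0.
  by rewrite mulr1 rmorphXn.
(* The edges are naturally indexed by pairs (scalar unit, basis vector); [s] renumbers these pairs
   by ['I_(real_dim V)]. *)
pose I := ('I_(scalar_dim k) * 'I_p)%type.
have cardI : real_dim V = #|{: I}|.
  by rewrite card_prod !card_ord /real_dim dV /scalar_dim; case: (k); rewrite ?mul1n.
pose s (l : 'I_(real_dim V)) : I := enum_val (cast_ord cardI l).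
have s_bij : bijective s.
  exists (fun x => cast_ord (esym cardI) (enum_rank x)) => x.
    by rewrite /s enum_valK cast_ordK.
  by rewrite /s cast_ordKV enum_rankK.
pose b (x : I) := scalar_unit R k x.1 *: e`_x.2.
have pf : proj_factor dotp V W = \prod_(l < real_dim V) c (s l).2.
  apply: (@proj_factor_orthonormal _ _ _ dotp V W (b \o s)).
  - by move=> l; rewrite /= /b memvZ ?mV.
  - move=> v vV; rewrite [LHS](orthonormal_expand oe); last by rewrite -eV.
    rewrite -(reindex s (onW_bij _ s_bij) (P := xpredT)
      (F := fun x => ofR k (ReK (ip dotp (b x) v)) *: b x)) /=.
    rewrite -(pair_bigA _ (fun a i => ofR k (ReK (ip dotp (b (a, i)) v)) *: b (a, i))) /=.
    rewrite exchange_big /=; apply: eq_bigr => i _.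
    rewrite {1}[ip _ _ _]scalar_unit_expand scaler_suml; apply: eq_bigr => a _.
    by rewrite /b /= ipZl scalerA.
  - move=> l l'; rewrite /b /= ipZl ipZr orthonormal_ip ?size_tuple //.
    rewrite mulrA -(bij_eq s_bij) -pair_eqE /= val_eqE.
    case: (_ == _ :> 'I_p); rewrite ?mulr1 ?mulr0 ?raddf0 ?andbT ?andbF //.
    exact: scalar_unit_orthonormal.
  - move=> l l' /=.
    rewrite /b /orth_proj !linearZ /= -!/(orth_proj dotp W _) ipZl ipZr PePe //.
    rewrite mulrA -(bij_eq s_bij) -pair_eqE /= -!val_eqE /=.
    case: (val _ =P val _ :> nat) => _; last by rewrite mulr0 raddf0 andbF.
    rewrite mulrC ReK_ofRM scalar_unit_orthonormal andbT -val_eqE /=.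
    by case: eqP => _; rewrite ?mulr1 ?mulr0.
  - by move=> l; case/andP: (c01 (s l).2).
(* Each [c i] occurs once per scalar unit, so the ratio is the product to the power [scalar_dim k];
   the square root in the complex [asym_angle] undoes the square. *)
rewrite -(reindex s (onW_bij _ s_bij) (P := xpredT) (F := fun x : I => c x.2)) /= in pf.
rewrite -(pair_bigA _ (fun (a : 'I_(scalar_dim k)) (i : 'I_p) => c i)) /= in pf.
rewrite prodr_const card_ord in pf.
(* These bounds place the product in the interval [-1, 1], where [acosK] applies. *)
have P0 : 0 <= \prod_(i < p) c i by apply: prodr_ge0 => i _; case/andP: (c01 i).
have P1 : \prod_(i < p) c i <= 1 by apply: prodr_ile1 => i _.
rewrite /asym_angle {}pf; case: (k); rewrite /= ?expr1 ?sqrtr_sqr ?(ger0_norm P0) acosK //.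
  by rewrite in_itv /= P1 andbT (le_trans _ P0) // oppr_le0.
by rewrite in_itv /= P1 andbT (le_trans _ P0) // oppr_le0.
Qed.

End Contraction.

Theorem theoremA6 (R : realType) (k : scalar_kind) (X : vectType (scalar_field R k))
    (dotp : {dot X for conjK R k}) (p q : nat) (A B : ext X)
    (hA : is_blade p A) (hB : is_blade q B) (A0 : A != 0) (B0 : B != 0)
    (e : p.-tuple X) (f : q.-tuple X) (epsA epsB : scalar_field R k)
    (BP Bperp : ext X)
    (hdec : proj_orth_decomposition dotp A B e f epsA epsB BP Bperp)
    (Theta : scalar_field R k)
    (hTheta : is_oriented_angle dotp (blade_space p A) (blade_space q B)
                epsA epsB Theta) :
  contraction dotp p q A B =
  (ofR k (ext_norm dotp A * ext_norm dotp B) * cosK Theta) *: Bperp.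
Proof.
move: hdec hTheta => [pb [_ eA] [_ eB] [_ _ eP]] [_ ->].
have [c [c01 cq hef]] := principal_bases_cos pb.
have [oe of_ _] := pb.
rewrite (cos_asym_angle oe of_ c01 cq hef).
have [pq|qp] := leqP p q; last first.
  (* The contraction is 0 by definition, and the product contains the factor [c q = 0]. *)
  rewrite /contraction leqNgt qp /= (bigD1 (Ordinal qp)) //= cq // mul0r rmorph0.
  by rewrite !mulr0 scale0r.
have eP' : Bperp = wedge (drop p f) by rewrite eP (minn_idPl pq).
have szd : size (drop p f) = (q - p)%N by rewrite size_drop size_tuple.
apply: contraction_eq => // [|s ss].
  by rewrite eP' -szd; apply/is_gradeZ/is_grade_wedge.
rewrite eP' [X in _ = ext_dot _ (X * _) _]eA [X in _ = ext_dot _ _ X]eB -scalerAl -wedge_cat /ext_dot ext_ipZl !ext_ipZr.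
(* Cutting [f] at [p] makes [e] against [take p f] diagonal and [e] orthogonal to [drop p f]; the
   remaining block is the pairing of [s] with [Bperp]. *)
rewrite -!/(ext_dot dotp _ _) !ext_dot_wedge -[X in gram_det _ (e ++ s) X](cat_take_drop p).
rewrite gram_det_block; first last.
- move=> x y /tnthP[i ->] /(nthP 0)[j]; rewrite szd => jq <-.
  rewrite (tnth_nth 0) nth_drop hef //; first by rewrite ltn_eqF // (leq_trans (ltn_ord i)) // leq_addr.
  by rewrite -ltn_subRL.
- by rewrite size_takel !size_tuple.
rewrite (@gram_det_diag _ _ _ p e (take p f) (fun i => ofR k (c i))) ?size_takel ?size_tuple //; last first.
  by move=> i j ip jp; rewrite nth_take // hef // (leq_trans jp).
rewrite -rmorph_prod !rmorphM conjK_ofR; ring.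
Qed.
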